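(* Let $\mathcal{K}\subseteq\mathbb{R}^m$ be a closed convex cone, $\mathbf{D}\in\mathbb{R}^{m\times n}$, $\mathbf{d}\in\mathbb{R}^m$, $\mathbf{v}\in\mathbb{R}^n$, $\mathbf{W}=\mathrm{diag}(\mathbf{w})\in\mathbb{R}^{n\times n}$ with $\mathbf{v},\mathbf{w}\ge\mathbf{0}$, and for $\mathbf{x}\in\{0,1\}^n$ let $$\mathcal{U}^{\mathcal{K}}(\mathbf{x})=\{\boldsymbol{\xi}\in\mathbb{R}^n\mid\mathbf{d}-\mathbf{D}\boldsymbol{\xi}\in\mathcal{K},\ \boldsymbol{\xi}\le\mathbf{v}+\mathbf{W}(\mathbf{e}-\mathbf{x}),\ \boldsymbol{\xi}\ge\mathbf{0}\}.$$ Let $\overline{\boldsymbol{\Pi}}=\mathrm{diag}(\overline{\boldsymbol{\pi}})$, where $\overline{\boldsymbol{\pi}}\in\mathbb{R}^n$ is an element-wise upper bound on the optimal dual variables $\boldsymbol{\pi}(\mathbf{x},\mathbf{y})$ (in the sense made precise in the context). Define $$h(\mathbf{x},\mathbf{y})=\max_{\boldsymbol{\xi}}\{\mathbf{y}^\top\boldsymbol{\xi}\mid\boldsymbol{\xi}\in\mathcal{U}^{\mathcal{K}}(\mathbf{x})\},$$ $$\bar h(\mathbf{x},\mathbf{y})=\max_{\boldsymbol{\xi},\boldsymbol{\zeta}}\{(\mathbf{y}-\overline{\boldsymbol{\Pi}}\mathbf{x})^\top\boldsymbol{\xi}+\mathbf{y}^\top\boldsymbol{\zeta}\mid\mathbf{d}-\mathbf{D}(\boldsymbol{\xi}+\boldsymbol{\zeta})\in\mathcal{K},\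 \boldsymbol{\xi}\le\mathbf{W}\mathbf{e},\ \boldsymbol{\zeta}\le\mathbf{v},\ \boldsymbol{\xi},\boldsymbol{\zeta}\ge\mathbf{0}\}.$$ If for every $\mathbf{x}\in\{0,1\}^n$ there exists a Slater point of $\mathcal{U}^{\mathcal{K}}(\mathbf{x})$, then for all $\mathbf{x}\in\{0,1\}^n$ and all $\mathbf{y}\in\mathcal{Y}$, $$h(\mathbf{x},\mathbf{y})=\bar h(\mathbf{x},\mathbf{y}).$$
   Context: $\mathbf{e}$ is the vector of ones; vector inequalities are component-wise; $\mathcal{K}^*=\{\mathbf{t}\mid\mathbf{t}^\top\mathbf{k}\ge0\ \forall\mathbf{k}\in\mathcal{K}\}$ is the dual cone. A Slater point of $\mathcal{U}^{\mathcal{K}}(\mathbf{x})$ is a point $\boldsymbol{\xi}\in\mathcal{U}^{\mathcal{K}}(\mathbf{x})$ with $\mathbf{d}-\mathbf{D}\boldsymbol{\xi}$ in the relative interior of $\mathcal{K}$. $\mathcal{Y}\subseteq\mathbb{R}^n$ is the set of vectors $\mathbf{y}$ under consideration (those allowed in the overall optimization problem). $\boldsymbol{\pi}(\mathbf{x},\mathbf{y})$ denotes the optimal dual variable of the constraint $\boldsymbol{\xi}\le\mathbf{v}+\mathbf{W}(\mathbf{e}-\mathbf{x})$, i.e. the $\boldsymbol{\pi}$-part of an optimal solution of the conic dual $$\min_{\boldsymbol{\pi},\mathbf{q}}\{\mathbf{q}^\top\mathbf{d}+\boldsymbol{\pi}^\top\mathbf{v}+\boldsymbol{\pi}^\top\mathbf{W}(\mathbf{e}-\mathbf{x})\mid\boldsymbol{\pi}^\top+\mathbf{q}^\top\mathbf{D}\ge\mathbf{y}^\top,\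 \boldsymbol{\pi}\ge\mathbf{0},\ \mathbf{q}\in\mathcal{K}^*\}.$$ The standing assumption on $\overline{\boldsymbol{\pi}}$ is: for every $\mathbf{x}\in\{0,1\}^n$ and $\mathbf{y}\in\mathcal{Y}$ there is an optimal dual solution with $\boldsymbol{\pi}(\mathbf{x},\mathbf{y})\le\overline{\boldsymbol{\pi}}$ component-wise. *)

(* Defs.v *)
From HB Require Import structures.
From mathcomp Require Import all_boot all_order all_algebra.
From mathcomp Require Import all_classical all_reals all_analysis.
Set Implicit Arguments.
Unset Strict Implicit.
Unset Printing Implicit Defensive.
Import Order.TTheory GRing.Theory Num.Theory.
Import numFieldNormedType.Exports.
Local Open Scope classical_set_scope.
Local Open Scope ring_scope.

Definition dotv (R : realType) (n : nat) (u v : 'cV[R]_n) : R :=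
  (u^T *m v) ord0 ord0.

Definition vle (R : realType) (n : nat) (u v : 'cV[R]_n) : Prop :=
  forall i : 'I_n, u i ord0 <= v i ord0.

Definition ones (R : realType) (n : nat) : 'cV[R]_n := const_mx 1.

Definition diagc (R : realType) (n : nat) (w : 'cV[R]_n) : 'M[R]_n :=
  diag_mx w^T.

Definition binary (R : realType) (n : nat) : set 'cV[R]_n :=
  [set x | forall i : 'I_n, x i ord0 = 0 \/ x i ord0 = 1].

Definition is_cone (R : realType) (m : nat) (K : set 'cV[R]_m) : Prop :=
  K !=set0 /\ forall (a : R) (k : 'cV[R]_m), 0 <= a -> K k -> K (a *: k).

Definition closed_convex_cone (R : realType) (m : nat) (K : set 'cV[R]_m) :
    Prop :=
  [/\ closed K, convex_set K & is_cone K].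

Definition dual_cone (R : realType) (m : nat) (K : set 'cV[R]_m) :
    set 'cV[R]_m :=
  [set t | forall k, K k -> 0 <= dotv t k].

Definition affine_hull (R : realType) (m : nat) (A : set 'cV[R]_m) :
    set 'cV[R]_m :=
  [set z | exists (N : nat) (a : 'I_N -> R) (p : 'I_N -> 'cV[R]_m),
     [/\ forall i, A (p i), \sum_(i < N) a i = 1
       & z = \sum_(i < N) a i *: p i]].

(* The interior of A in the subspace topology of its affine hull; the
   topology on 'cV[R]_m is the product (i.e. Euclidean) one. *)
Definition relint (R : realType) (m : nat) (A : set 'cV[R]_m) :
    set 'cV[R]_m :=
  [set z | A z /\ \forall u \near z, affine_hull A u -> A u].

(* U^K(x) for W = diag(w). *)
Definition uset (R : realType) (m n : nat) (K : set 'cV[R]_m)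
    (D : 'M[R]_(m, n)) (d : 'cV[R]_m) (v w x : 'cV[R]_n) : set 'cV[R]_n :=
  [set xi | [/\ K (d - D *m xi),
                vle xi (v + diagc w *m (ones R n - x))
              & vle 0 xi]].

Definition slater_point (R : realType) (m n : nat) (K : set 'cV[R]_m)
    (D : 'M[R]_(m, n)) (d : 'cV[R]_m) (v w x : 'cV[R]_n) : set 'cV[R]_n :=
  [set xi | uset K D d v w x xi /\ relint K (d - D *m xi)].

Definition dual_feasible (R : realType) (m n : nat) (K : set 'cV[R]_m)
    (D : 'M[R]_(m, n)) (y : 'cV[R]_n) (p : 'cV[R]_n) (q : 'cV[R]_m) : Prop :=
  [/\ vle y (p + D^T *m q), vle 0 p & dual_cone K q].

Definition dual_obj (R : realType) (m n : nat)
    (d : 'cV[R]_m) (v w x : 'cV[R]_n) (p : 'cV[R]_n) (q : 'cV[R]_m) : R :=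
  dotv q d + dotv p v + dotv p (diagc w *m (ones R n - x)).

Definition dual_optimal (R : realType) (m n : nat) (K : set 'cV[R]_m)
    (D : 'M[R]_(m, n)) (d : 'cV[R]_m) (v w x y : 'cV[R]_n)
    (p : 'cV[R]_n) (q : 'cV[R]_m) : Prop :=
  dual_feasible K D y p q /\
  forall p' q', dual_feasible K D y p' q' ->
    dual_obj d v w x p q <= dual_obj d v w x p' q'.

(* Optimal dual solutions need not be unique: only one of them is required to
   satisfy the bound. *)
Definition dual_bound (R : realType) (m n : nat) (K : set 'cV[R]_m)
    (D : 'M[R]_(m, n)) (d : 'cV[R]_m) (v w : 'cV[R]_n)
    (Y : set 'cV[R]_n) (pibar : 'cV[R]_n) : Prop :=
  forall x y : 'cV[R]_n, binary x -> Y y ->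
    exists p q, dual_optimal K D d v w x y p q /\ vle p pibar.

Definition is_max (R : realType) (A : set R) (M : R) : Prop :=
  A M /\ ubound A M.

Definition h_values (R : realType) (m n : nat) (K : set 'cV[R]_m)
    (D : 'M[R]_(m, n)) (d : 'cV[R]_m) (v w x y : 'cV[R]_n) : set R :=
  [set dotv y xi | xi in uset K D d v w x].

Definition hbar_feasible (R : realType) (m n : nat) (K : set 'cV[R]_m)
    (D : 'M[R]_(m, n)) (d : 'cV[R]_m) (v w : 'cV[R]_n) :
    set ('cV[R]_n * 'cV[R]_n) :=
  [set z | [/\ K (d - D *m (z.1 + z.2)),
               vle z.1 (diagc w *m ones R n),
               vle z.2 v,
               vle 0 z.1
             & vle 0 z.2]].

Definition hbar_values (R : realType) (m n : nat) (K : set 'cV[R]_m)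
    (D : 'M[R]_(m, n)) (d : 'cV[R]_m) (v w pibar x y : 'cV[R]_n) : set R :=
  [set dotv (y - diagc pibar *m x) z.1 + dotv y z.2
     | z in hbar_feasible K D d v w].

(* sup is 0 on sets that are empty or unbounded above, and need not be
   attained: that h and hbar are maxima has to be stated with is_max. *)
Definition h (R : realType) (m n : nat) (K : set 'cV[R]_m)
    (D : 'M[R]_(m, n)) (d : 'cV[R]_m) (v w x y : 'cV[R]_n) : R :=
  sup (h_values K D d v w x y).

Definition hbar (R : realType) (m n : nat) (K : set 'cV[R]_m)
    (D : 'M[R]_(m, n)) (d : 'cV[R]_m) (v w pibar x y : 'cV[R]_n) : R :=
  sup (hbar_values K D d v w pibar x y).

(* Main.v *)
(* Splitting [xi] into [min xi v] and the rest shows that every value of h is a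
   value of hbar.  Conversely, weak duality bounds hbar by the dual objective at
   an optimal [(p, q)] with [p <= pibar]: where [x i = 1], the term
   [p i * z1 i] is absorbed by the penalty [pibar i * z1 i].  It remains to see
   that the conic dual has no gap.  As the primal feasible set lies in a box,
   for each [M] above the primal maximum the compact convex set of all
   [(y . xi - M, d - D xi)], [xi] in the box, is disjoint from the closed cone
   [R_+ * K]; a separating hyperplane is a dual solution of value below [M]. *)
Require Import Defs.
From HB Require Import structures.
From mathcomp Require Import all_boot all_order all_algebra.
From mathcomp Require Import all_classical all_reals all_analysis.
From mathcomp Require Import ring lra.
Set Implicit Arguments.
Unset Strict Implicit.
Unset Printing Implicit Defensive.
Import Order.TTheory GRing.Theory Num.Theory.
Import numFieldNormedType.Exports.
Local Open Scope classical_set_scope.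
Local Open Scope ring_scope.

(** * Scalar products and continuity *)

Lemma mx_continuous (T U : topologicalType) (m n : nat)
    (f : T -> 'M[U]_(m, n)) :
  (forall i j, continuous (fun x => f x i j)) -> continuous f.
Proof.
move=> fc x A [P xP PA].
apply: (filterS (P := [set y | forall i j, P i j (f y i j)])).
  by move=> y Py; exact: PA.
apply: filter_forall => i; apply: filter_forall => j.
exact: fc (xP i j).
Qed.

Lemma dotvE (R : realType) (n : nat) (u v : 'cV[R]_n) :
  dotv u v = \sum_(i < n) u i ord0 * v i ord0.
Proof. by rewrite /dotv mxE; apply: eq_bigr => i _; rewrite mxE. Qed.

Lemma dotvC (R : realType) (n : nat) (u v : 'cV[R]_n) : dotv u v = dotv v u.
Proof. by rewrite !dotvE; apply: eq_bigr => i _; rewrite mulrC. Qed.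

Lemma dotvDr (R : realType) (n : nat) (u v1 v2 : 'cV[R]_n) :
  dotv u (v1 + v2) = dotv u v1 + dotv u v2.
Proof. by rewrite /dotv mulmxDr mxE. Qed.

Lemma dotvNr (R : realType) (n : nat) (u v : 'cV[R]_n) :
  dotv u (- v) = - dotv u v.
Proof. by rewrite /dotv mulmxN mxE. Qed.

Lemma dotvZr (R : realType) (n : nat) (a : R) (u v : 'cV[R]_n) :
  dotv u (a *: v) = a * dotv u v.
Proof. by rewrite /dotv -scalemxAr mxE. Qed.

Lemma dotvDl (R : realType) (n : nat) (u1 u2 v : 'cV[R]_n) :
  dotv (u1 + u2) v = dotv u1 v + dotv u2 v.
Proof. by rewrite dotvC dotvDr !(dotvC v). Qed.

Lemma dotvNl (R : realType) (n : nat) (u v : 'cV[R]_n) :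
  dotv (- u) v = - dotv u v.
Proof. by rewrite dotvC dotvNr dotvC. Qed.

Lemma dotvZl (R : realType) (n : nat) (a : R) (u v : 'cV[R]_n) :
  dotv (a *: u) v = a * dotv u v.
Proof. by rewrite dotvC dotvZr dotvC. Qed.

Lemma dotv_ge0 (R : realType) (n : nat) (u : 'cV[R]_n) : 0 <= dotv u u.
Proof. by rewrite dotvE; apply: sumr_ge0 => i _; rewrite -expr2 sqr_ge0. Qed.

Lemma sqr_coord_le_dotv (R : realType) (n : nat) (u : 'cV[R]_n) (i : 'I_n) :
  u i ord0 ^+ 2 <= dotv u u.
Proof.
rewrite dotvE (bigD1 i) //= -expr2 lerDl.
by apply: sumr_ge0 => j _; rewrite -expr2 sqr_ge0.
Qed.

Lemma dotv_eq0 (R : realType) (n : nat) (u : 'cV[R]_n) : dotv u u = 0 -> u = 0.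
Proof.
move=> u0; apply/matrixP => i j; rewrite mxE (ord1 j); apply/eqP.
by rewrite -sqrf_eq0 eq_le sqr_ge0 andbT -u0 sqr_coord_le_dotv.
Qed.

Lemma dotv_continuous (R : realType) (T : topologicalType) (n : nat)
    (f g : T -> 'cV[R]_n) :
  continuous f -> continuous g -> continuous (fun x => dotv (f x) (g x)).
Proof.
move=> fc gc; under eq_fun do rewrite dotvE.
apply: (continuous_big (op := +%R)) => [|i _ x]; first exact: add_continuous.
have coordc (h : T -> 'cV[R]_n) : continuous h ->
    {for x, continuous (fun y => h y i ord0)}.
  move=> hc.
  exact: (@continuous_comp _ _ _ h (fun M => M i ord0) x (hc x)
    (@coord_continuous R n 1 i ord0 (h x))).
by apply: continuousM; exact: coordc.
Qed.

Lemma mulmx_continuous (R : realType) (m n p : nat) (D : 'M[R]_(m, n)) :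
  continuous (fun M : 'M[R]_(n, p) => D *m M).
Proof.
apply: mx_continuous => i j; under eq_fun do rewrite mxE.
apply: (continuous_big (op := +%R)) => [|k _ x]; first exact: add_continuous.
apply: continuousM; first exact: cst_continuous.
exact: coord_continuous.
Qed.

Lemma affine_continuous (R : realType) (m n p : nat) (D : 'M[R]_(m, n))
    (d : 'M[R]_(m, p)) :
  continuous (fun x : 'M[R]_(n, p) => d - D *m x).
Proof.
move=> x; have := @continuousB R 'M[R]_(m, p) _ (cst d) (mulmx D) x.
by apply; [exact: cst_continuous | exact: mulmx_continuous].
Qed.

(** * Compact boxes, convex sets and cones *)

Lemma cV_box_compact (R : realType) (n : nat) (l u : 'cV[R]_n) :
  compact [set x : 'cV[R]_n | vle l x /\ vle x u].
Proof.
(* The box is the transpose of a product of segments, which is compact by Tychonoff. *)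
pose B := [set x : 'rV[R]_n |
  forall i, `[l i ord0, u i ord0]%classic (x ord0 i)].
have -> : [set x : 'cV[R]_n | vle l x /\ vle x u] = trmx @` B.
  apply/seteqP; split=> [x [lx xu]|_ [x Bx <-]] /=.
    exists x^T; last exact: trmxK.
    by move=> i /=; rewrite in_itv /= mxE lx xu.
  by split=> i; have := Bx i; rewrite /= in_itv /= mxE => /andP[].
apply: continuous_compact; last first.
  by apply: (rV_compact (A := fun i => `[l i ord0, u i ord0]%classic)) => i;
    exact: segment_compact.
apply: continuous_subspaceT; apply: mx_continuous => i j.
by under eq_fun do rewrite mxE; exact: coord_continuous.
Qed.

(** Trades the bundled scalar [Itv01] for a real [t] with two inequalities. *)
Lemma convex_setP (R : realType) (n : nat) (A : set 'cV[R]_n) :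
  convex_set A <-> forall t a b, 0 <= t -> t <= 1 -> A a -> A b ->
    A (t *: a + (1 - t) *: b).
Proof.
split=> [cA t a b t0 t1 Aa Ab|cA a b t].
  have t01 : 0 <= t <= 1 by rewrite t0 t1.
  have := cA a b (Itv01 t0 t1).
  by rewrite !inE; apply.
rewrite !inE => Aa Ab; apply: cA => //.
Qed.

(** The sum is twice the midpoint, which convexity puts in [C]. *)
Lemma cone_add (R : realType) (n : nat) (C : set 'cV[R]_n) (a b : 'cV[R]_n) :
  closed_convex_cone C -> C a -> C b -> C (a + b).
Proof.
case=> _ /convex_setP cvxC [_ coneC] Ca Cb.
rewrite -[a + b](scalerK (a := 2^-1 :> R)); last by rewrite invr_eq0 pnatr_eq0.
rewrite invrK; apply: coneC => //.
have -> : 2^-1 *: (a + b) = 2^-1 *: a + (1 - 2^-1) *: b.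
  by rewrite scalerDr; congr (_ + _ *: _); lra.
by apply: cvxC => //; lra.
Qed.

Lemma cone0 (R : realType) (n : nat) (C : set 'cV[R]_n) : is_cone C -> C 0.
Proof. by case=> [[c Cc] coneC]; rewrite -(scale0r c); exact: coneC. Qed.

(** * Separation of a compact convex set from a closed convex cone *)

Lemma nonneg_slope (R : realType) (b c : R) : 0 <= c ->
  (forall t, 0 <= t -> t <= 1 -> 0 <= 2 * t * b + t ^+ 2 * c) -> 0 <= b.
Proof.
move=> c0 bc; rewrite leNgt; apply/negP => b0.
(* At this [t], [t * c <= - b], so the quadratic is at most [t * b < 0]. *)
pose t := - b / (c - b).
have cb : 0 < c - b by lra.
have t0 : 0 < t by rewrite divr_gt0 //; lra.
have t1 : t <= 1 by rewrite ler_pdivrMr //; lra.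
have tc : t * c <= - b by rewrite mulrAC ler_pdivrMr //; nra.
have := bc t (ltW t0) t1; nra.
Qed.

(** Along the segment from [z] to [u] the squared norm is smallest at [z], so its slope
    [2 * dotv z (u - z)] there is nonnegative. *)
Lemma min_norm_variational (R : realType) (n : nat) (A : set 'cV[R]_n)
    (z u : 'cV[R]_n) :
  convex_set A -> A z -> A u -> (forall a, A a -> dotv z z <= dotv a a) ->
  dotv z z <= dotv z u.
Proof.
move=> /convex_setP cA Az Au zmin.
suff : 0 <= dotv z (u - z) by rewrite dotvDr dotvNr subr_ge0.
apply: (@nonneg_slope _ _ (dotv (u - z) (u - z))); first exact: dotv_ge0.
move=> t t0 t1; have := zmin _ (cA t u z t0 t1 Au Az).
have -> : t *: u + (1 - t) *: z = z + t *: (u - z).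
  by rewrite scalerBl scale1r scalerBr addrCA.
move: (u - z) => w; rewrite dotvDl !dotvDr !dotvZl !dotvZr (dotvC w z) => ?.
lra.
Qed.

(** If [a0] in [A] and [c0] in [C] are at minimal distance, then [c0 - a0] is a separating
    normal. *)
Lemma separate_compact_cone (R : realType) (n : nat) (A C : set 'cV[R]_n) :
    A !=set0 -> compact A -> convex_set A -> closed_convex_cone C ->
    A `&` C = set0 ->
  exists2 q, dual_cone C q & forall a, A a -> dotv q a < 0.
Proof.
move=> [a1 Aa1] cptA cvxA coneC AC0.
have [closedC cvxC isC] := coneC; have C0 := cone0 isC.
have normc : continuous (fun a : 'cV[R]_n => dotv a a).
  by apply: dotv_continuous => x; exact: cvg_id.
have [a2 _ a2max] := compact_EVT_max (ex_intro _ _ Aa1) cptA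
  (continuous_subspaceT normc).
pose N := dotv a2 a2.
have N_ge a : A a -> dotv a a <= N by move=> Aa; apply: a2max; rewrite inE.
have N0 : 0 <= N by exact: dotv_ge0.
(* By minimality only the part of [C] in a box of radius [rho] matters: outside
   it, [dotv (a - c) (a - c)] exceeds its value [<= N] at [(a1, 0)]. *)
pose rho := 2 * (N + 1).
pose B := [set x : 'cV[R]_n | vle (const_mx (- rho)) x /\ vle x (const_mx rho)].
have cptT : compact (A `*` (B `&` C)).
  apply: compact_setX => //; apply: compact_closedI => //.
  exact: cV_box_compact.
pose f (p : 'cV[R]_n * 'cV[R]_n) := dotv (p.1 - p.2) (p.1 - p.2).
have fc : continuous f.
  by apply: dotv_continuous => p; apply: cvgB; [exact: cvg_fst | exact: cvg_snd
    | exact: cvg_fst | exact: cvg_snd].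
have B0 : B 0 by split=> i; rewrite !mxE /rho; lra.
have T0 : A `*` (B `&` C) !=set0 by exists (a1, 0).
have [[a0 c0] /set_mem /= [Aa0 [_ Cc0]] fmin] :=
  compact_EVT_min T0 cptT (continuous_subspaceT fc).
pose z := a0 - c0.
have zmin a c : A a -> C c -> dotv z z <= dotv (a - c) (a - c).
  move=> Aa Cc; have [Bc|nBc] := pselect (B c).
    by apply: (fmin (a, c)); rewrite inE.
  have z_le : dotv z z <= N.
    apply: le_trans (N_ge _ Aa1).
    by have := fmin (a1, 0); rewrite /f /= subr0 inE; apply.
  apply: le_trans z_le _; rewrite leNgt; apply/negP => ac_lt.
  apply: nBc.
  (* [N + 1] dominates the square root of [N]. It thus bounds the coordinates of [a] and of [a - c],
     and [rho] bounds those of their difference [c]. *)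
  have small x : x ^+ 2 <= N -> - (N + 1) <= x <= N + 1.
    by move=> x2; apply/andP; split; nra.
  have coordB i : - rho <= c i ord0 <= rho.
    have := small _ (le_trans (sqr_coord_le_dotv a i) (N_ge _ Aa)).
    have := small _ (le_trans (sqr_coord_le_dotv (a - c) i) (ltW ac_lt)).
    by rewrite !mxE /rho => /andP[? ?] /andP[? ?]; apply/andP; split; lra.
  by split=> i; have /andP[] := coordB i; rewrite mxE.
(* [z] is the point of least norm in the convex difference set [A - C]. *)
pose S := [set u | exists a c, [/\ A a, C c & u = a - c]].
have cvxS : convex_set S.
  apply/convex_setP => t _ _ t0 t1 [a [c [Aa Cc ->]]] [b [e [Ab Ce ->]]].
  exists (t *: a + (1 - t) *: b), (t *: c + (1 - t) *: e); split.
  - exact: (convex_setP _).1.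
  - exact: (convex_setP _).1.
  - by rewrite !scalerBr opprD addrACA.
have z_le a c : A a -> C c -> dotv z z <= dotv z a - dotv z c.
  move=> Aa Cc; rewrite -dotvNr -dotvDr; apply: (min_norm_variational cvxS).
  - by exists a0, c0.
  - by exists a, c.
  - by move=> _ [a' [c' [Aa' Cc' ->]]]; exact: zmin.
have z_gt0 : 0 < dotv z z.
  rewrite lt_neqAle dotv_ge0 andbT eq_sym; apply/eqP => /dotv_eq0 /eqP.
  rewrite subr_eq0 => /eqP a0c0.
  have : (A `&` C) a0 by split => //; rewrite a0c0.
  by rewrite AC0.
exists (- z) => [c Cc|a Aa]; rewrite dotvNl.
  (* Moving [c0] by [c] stays in [C]; comparing with [z] itself leaves [dotv z c <= 0]. *)
  have := z_le _ _ Aa0 (cone_add coneC Cc0 Cc).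
  have -> : dotv z z = dotv z a0 - dotv z c0 by rewrite -dotvNr -dotvDr.
  by rewrite dotvDr => ?; lra.
(* With the apex of the cone, [dotv z a >= dotv z z > 0]. *)
have := z_le _ _ Aa C0.
have -> : dotv z 0 = 0 by rewrite -(scale0r 0) dotvZr mul0r.
lra.
Qed.

(** * Strong duality for the conic problem *)

Lemma dotv_col_mx (R : realType) (m n : nat) (a1 a2 : 'cV[R]_m)
    (b1 b2 : 'cV[R]_n) :
  dotv (col_mx a1 b1) (col_mx a2 b2) = dotv a1 a2 + dotv b1 b2.
Proof. by rewrite /dotv tr_col_mx mul_row_col mxE. Qed.

Lemma dotv_trmx_mul (R : realType) (m n : nat) (D : 'M[R]_(m, n))
    (q : 'cV[R]_m) (x : 'cV[R]_n) :
  dotv (D^T *m q) x = dotv q (D *m x).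
Proof. by rewrite /dotv trmx_mul trmxK mulmxA. Qed.

Lemma dotv_le (R : realType) (n : nat) (u v x : 'cV[R]_n) :
  vle u v -> vle 0 x -> dotv u x <= dotv v x.
Proof.
move=> uv x0; rewrite !dotvE; apply: ler_sum => i _; apply: ler_wpM2r (uv i).
by have := x0 i; rewrite mxE.
Qed.

(** The first coordinate carries the surplus of the objective over [M], the others the conic
    constraint. *)
Lemma halfline_prod_cone (R : realType) (m : nat) (K : set 'cV[R]_m) :
  closed_convex_cone K ->
  closed_convex_cone
    [set z : 'cV[R]_(1 + m) | 0 <= usubmx z ord0 ord0 /\ K (dsubmx z)].
Proof.
case=> closedK /convex_setP cvxK coneK.
have K0 := cone0 coneK; case: coneK => _ coneK; split.
- apply: closedI.
    apply: (preimage_closed (f := fun z : 'cV[R]_(1 + m) => usubmx z ord0 ord0)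
      (D := [set x : R | 0 <= x])); last exact: closed_ge.
    by move=> z _; under eq_fun do rewrite mxE; exact: coord_continuous.
  apply: (preimage_closed (f := fun z : 'cV[R]_(1 + m) => dsubmx z)) => // z _.
  apply: mx_continuous => i j.
  by under eq_fun do rewrite mxE; exact: coord_continuous.
- apply/convex_setP => t a b t0 t1 [a0 Ka] [b0 Kb]; split.
    move: a0 b0; rewrite !mxE => a0 b0.
    by apply: addr_ge0; apply: mulr_ge0 => //; lra.
  by rewrite linearD !linearZ /=; exact: cvxK.
split; first by exists 0; split; rewrite ?linear0 ?mxE.
move=> a k a0 [k0 Kk]; split; last by rewrite linearZ /=; exact: coneK.
by move: k0; rewrite !mxE => k0; exact: mulr_ge0.
Qed.

(** Scaling the separating functional to give the objective weight 1 yields [q]; the cheapest [p]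
    for this [q] is the positive part of [y - D^T *m q]. *)
Lemma conic_no_gap (R : realType) (m n : nat) (K : set 'cV[R]_m)
    (D : 'M[R]_(m, n)) (d : 'cV[R]_m) (u y : 'cV[R]_n) (M : R) :
    closed_convex_cone K ->
    (exists xi, [/\ K (d - D *m xi), vle xi u & vle 0 xi]) ->
    (forall xi, K (d - D *m xi) -> vle xi u -> vle 0 xi -> dotv y xi < M) ->
  exists p q, dual_feasible K D y p q /\ dotv q d + dotv p u < M.
Proof.
move=> coneK [xi0 [Kxi0 xi0u xi00]] yltM.
have K0 : K 0 by case: coneK => _ _ /cone0.
pose box := [set x : 'cV[R]_n | vle 0 x /\ vle x u].
(* One affine map collects objective and constraint, so the image of the box is compact and
   convex. *)
pose E := col_mx (- y^T) D.
pose e : 'cV[R]_(1 + m) := col_mx (const_mx (- M)) d.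
pose g (x : 'cV[R]_n) : 'cV[R]_(1 + m) := e - E *m x.
have gE x : g x = col_mx (const_mx (dotv y x - M)) (d - D *m x).
  rewrite /g mul_col_mx opp_col_mx add_col_mx mulNmx opprK; congr col_mx.
  apply/matrixP => i j; rewrite [LHS]mxE [const_mx _ _ _]mxE [RHS]mxE addrC.
  by rewrite (ord1 i) (ord1 j).
have [|||||q' q'C q'A] := @separate_compact_cone R (1 + m) (g @` box)
    [set z : 'cV[R]_(1 + m) | 0 <= usubmx z ord0 ord0 /\ K (dsubmx z)].
- by exists (g xi0), xi0.
- apply: continuous_compact; last exact: cV_box_compact.
  by apply: continuous_subspaceT; exact: affine_continuous.
- apply/convex_setP => t _ _ t0 t1 [a [a0 au] <-] [b [b0 bu] <-].
  exists (t *: a + (1 - t) *: b).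
    split=> i; have := a0 i; have := b0 i; have := au i; have := bu i;
      rewrite !mxE; nra.
  rewrite /g mulmxDr -!scalemxAr !scalerBr opprD addrACA; congr (_ + _).
  by rewrite -scalerDl addrC subrK scale1r.
- exact: halfline_prod_cone.
- apply/seteqP; split=> // _ [[x [x0 xu] <-]].
  rewrite gE /= col_mxKu col_mxKd mxE => -[].
  by move=> + Kx; have := yltM _ Kx xu x0; lra.
pose l := usubmx q' ord0 ord0; pose k := dsubmx q'.
have q'E a b : dotv q' (col_mx (const_mx a) b) = l * a + dotv k b.
  rewrite -[q' in LHS]vsubmxK dotv_col_mx; congr (_ + _).
  by rewrite dotvE big_ord1 [const_mx _ _ _]mxE.
(* Testing [q'] on the vectors [(1, 0)] and [(0, z)] splits its dual cone condition into [0 <= l]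
   and [dual_cone K k]. *)
have l0 : 0 <= l.
  have := q'C (col_mx (const_mx 1) 0).
  rewrite q'E mulr1 -[X in dotv k X](scale0r 0) dotvZr mul0r addr0; apply.
  by rewrite /= col_mxKu col_mxKd mxE.
have kK : dual_cone K k.
  move=> z Kz; have := q'C (col_mx (const_mx 0) z).
  by rewrite q'E mulr0 add0r; apply; rewrite /= col_mxKu col_mxKd mxE.
have lk_lt x : vle 0 x -> vle x u ->
    l * (dotv y x - M) + dotv k (d - D *m x) < 0.
  by move=> x0 xu; rewrite -q'E -gE; apply: q'A; exists x.
have lgt0 : 0 < l.
  (* For [l = 0] the feasible [xi0] would give [dotv k (d - D *m xi0) < 0], against [kK]. *)
  rewrite lt_neqAle l0 andbT eq_sym; apply/eqP => l_eq0.
  have := lk_lt _ xi00 xi0u; rewrite l_eq0 mul0r add0r.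
  by rewrite ltNge kK.
(* [x] maximizes [dotv r] over the box. *)
pose q := l^-1 *: k; pose r := y - D^T *m q.
pose p : 'cV[R]_n := \col_i Order.max 0 (r i ord0).
pose x : 'cV[R]_n := \col_i (if 0 < r i ord0 then u i ord0 else 0).
have u0 i : 0 <= u i ord0.
  by apply: le_trans (xi0u i); have := xi00 i; rewrite mxE.
(* Both sides sum [r i * u i] over the [i] with [r i > 0]. *)
have pu : dotv p u = dotv r x.
  rewrite !dotvE; apply: eq_bigr => i _; rewrite !mxE.
  by case: ltP => _; rewrite ?mul0r ?mulr0.
exists p, q; split; first split.
- by move=> i; rewrite mxE -lerBlDr [p i ord0]mxE le_max !mxE lexx orbT.
- by move=> i; rewrite !mxE le_max lexx.
- by move=> z Kz; rewrite dotvZl mulr_ge0 ?invr_ge0 //; exact: kK.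
(* This is [lk_lt] at [x] divided by [l]; its left side equals [dotv r x + dotv q d - M]. *)
have : dotv y x - M + dotv q (d - D *m x) < 0.
  rewrite -(pmulr_rlt0 _ lgt0) mulrDr -dotvZl scalerA divff ?gt_eqF // scale1r.
  by apply: lk_lt => i; rewrite !mxE; case: ifP.
by rewrite pu dotvDl dotvNl dotv_trmx_mul dotvDr dotvNr; lra.
Qed.

(** * Comparison of the two maximization problems *)

Lemma diagc_mulE (R : realType) (n : nat) (w x : 'cV[R]_n) (i : 'I_n) :
  (diagc w *m x) i ord0 = w i ord0 * x i ord0.
Proof. by rewrite /diagc mul_diag_mx !mxE. Qed.

Lemma uset_boundE (R : realType) (n : nat) (v w x : 'cV[R]_n) (i : 'I_n) :
  (v + diagc w *m (ones R n - x)) i ord0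
  = v i ord0 + w i ord0 * (1 - x i ord0).
Proof. by rewrite mxE diagc_mulE !mxE. Qed.

Lemma uset_compact (R : realType) (m n : nat) (K : set 'cV[R]_m)
    (D : 'M[R]_(m, n)) (d : 'cV[R]_m) (v w x : 'cV[R]_n) :
  closed K -> compact (uset K D d v w x).
Proof.
move=> closedK.
have -> : uset K D d v w x =
    [set xi | vle 0 xi /\ vle xi (v + diagc w *m (ones R n - x))] `&`
    (fun xi => d - D *m xi) @^-1` K.
  by apply/seteqP; split=> [xi []|xi [[]]].
apply: compact_closedI; first exact: cV_box_compact.
by apply: preimage_closed => // xi _; exact: affine_continuous.
Qed.

Lemma is_max_sup (R : realType) (A : set R) (M : R) : is_max A M -> sup A = M.
Proof.
case=> AM ubM; apply/eqP; rewrite eq_le; apply/andP; split.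
  by apply: ge_sup => //; exists M.
by apply: ub_le_sup => //; exists M.
Qed.

Lemma hbar_weak_duality (R : realType) (m n : nat) (K : set 'cV[R]_m)
    (D : 'M[R]_(m, n)) (d : 'cV[R]_m) (v w x y pibar p : 'cV[R]_n)
    (q : 'cV[R]_m) :
  binary x -> dual_feasible K D y p q -> vle p pibar ->
  ubound (hbar_values K D d v w pibar x y) (dual_obj d v w x p q).
Proof.
move=> xb [yp p0 qK] ppb _ [[z1 z2] [/= Kz z1w z2v z10 z20] <-].
have y_le : dotv y (z1 + z2) <= dotv p (z1 + z2) + dotv q d.
  have z0 : vle 0 (z1 + z2).
    by move=> i; have := z10 i; have := z20 i; rewrite !mxE; lra.
  apply: le_trans (dotv_le yp z0) _.
  rewrite dotvDl dotv_trmx_mul lerD2l -subr_ge0 -dotvNr -dotvDr.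
  exact: qK.
(* The rest holds coordinatewise: [z2 <= v] always, [z1 i <= w i] settles [x i = 0], and
   [p i <= pibar i] settles [x i = 1]. *)
suff: dotv p z1 + dotv p z2 - dotv (diagc pibar *m x) z1
    <= dotv p v + dotv p (diagc w *m (ones R n - x)).
  by rewrite /dual_obj /= dotvDl dotvNl; move: y_le;
    rewrite !dotvDr => ? ?; lra.
rewrite !dotvE -!big_split /= -sumrB; apply: ler_sum => i _.
rewrite !diagc_mulE !mxE.
have := z1w i; rewrite diagc_mulE mxE mulr1.
have := z2v i; have := z10 i; have := p0 i; have := ppb i; rewrite !mxE.
by case: (xb i) => -> *; nra.
Qed.

(** Where [x i = 1], [xi] is bounded by [v] and has no excess to penalize; where [x i = 0], the
    penalty vanishes and the excess is at most [w i]. *)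
Lemma h_values_sub_hbar_values (R : realType) (m n : nat) (K : set 'cV[R]_m)
    (D : 'M[R]_(m, n)) (d : 'cV[R]_m) (v w pibar x y : 'cV[R]_n) :
  vle 0 v -> vle 0 w -> binary x ->
  h_values K D d v w x y `<=` hbar_values K D d v w pibar x y.
Proof.
move=> v0 w0 xb _ [xi [Kxi xiu xi0] <-].
pose z2 : 'cV[R]_n := \col_i Order.min (xi i ord0) (v i ord0).
have z2E i : z2 i ord0 = Order.min (xi i ord0) (v i ord0) by rewrite mxE.
have z1E i : (xi - z2) i ord0 = xi i ord0 - z2 i ord0 by rewrite !mxE.
have Px0 : dotv (diagc pibar *m x) (xi - z2) = 0.
  rewrite dotvE big1 // => i _; rewrite diagc_mulE z1E z2E.
  have := xiu i; rewrite uset_boundE.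
  case: (xb i) => ->; first by rewrite mulr0 mul0r.
  by rewrite subrr mulr0 addr0 => /min_idPl ->; rewrite subrr mulr0.
exists (xi - z2, z2); last first.
  by rewrite /= dotvDl dotvNl Px0 oppr0 addr0 -dotvDr subrK.
split=> /=; first by rewrite subrK.
- move=> i; rewrite z1E z2E diagc_mulE mxE mulr1.
  have := xiu i; rewrite uset_boundE.
  have := w0 i; rewrite mxE => wi.
  by case: (xb i) => -> xiu_i; case: (leP (xi i ord0)) => ?; lra.
- by move=> i; rewrite z2E ge_min lexx orbT.
- by move=> i; rewrite z1E z2E mxE subr_ge0 ge_min lexx.
- move=> i; rewrite z2E le_min.
  by have := xi0 i; have := v0 i; rewrite !mxE => -> ->.
Qed.

Theorem proposition3 (R : realType) (m n : nat) (K : set 'cV[R]_m)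
    (D : 'M[R]_(m, n)) (d : 'cV[R]_m) (v w : 'cV[R]_n)
    (Y : set 'cV[R]_n) (pibar : 'cV[R]_n)
    (hK : closed_convex_cone K)
    (hv : vle 0 v) (hw : vle 0 w)
    (hpibar : dual_bound K D d v w Y pibar)
    (hslater : forall x : 'cV[R]_n, binary x -> slater_point K D d v w x !=set0) :
  forall x y : 'cV[R]_n, binary x -> Y y ->
    [/\ is_max (h_values K D d v w x y) (h K D d v w x y),
        is_max (hbar_values K D d v w pibar x y) (hbar K D d v w pibar x y)
      & h K D d v w x y = hbar K D d v w pibar x y].
Proof.
move=> x y xb Yy.
have [xi0 [Uxi0 _]] := hslater x xb.
have [closedK _ _] := hK.
have yc : continuous (dotv y).
  by apply: (dotv_continuous (f := cst y) (g := id));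
    [exact: cst_continuous | by move=> z; exact: cvg_id].
(* The feasible set is compact and contains the Slater point, so the maximum of [h] is attained. *)
have [xi /set_mem Uxi xi_max] := compact_EVT_max (ex_intro _ _ Uxi0)
  (@uset_compact _ _ _ _ D d v w x closedK) (continuous_subspaceT yc).
have h_max : is_max (h_values K D d v w x y) (dotv y xi).
  by split=> [|_ [z Uz <-]]; [exists xi | apply: xi_max; rewrite inE].
have [p [q [[pq_feas pq_opt] p_pibar]]] := hpibar x y xb Yy.
have obj_le : dual_obj d v w x p q <= dotv y xi.
  (* For each [e > 0] some dual solution has value below the primal maximum plus [e], and the
     optimal [(p, q)] does no worse. *)
  apply/ler_addgt0Pr => e e0.
  have [||p' [q' [pq'_feas pq'_lt]]] :=
    @conic_no_gap _ _ _ K D d (v + diagc w *m (ones R n - x)) y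
      (dotv y xi + e) hK.
  - by exists xi0.
  - move=> z Kz zu z0; apply: le_lt_trans (_ : _ <= dotv y xi) _; last by lra.
    by apply: xi_max; rewrite inE.
  apply: le_trans (pq_opt _ _ pq'_feas) _.
  by rewrite /dual_obj -addrA -dotvDr ltW.
(* The same number is a value of [hbar] by the splitting and an upper bound by weak duality. *)
have hbar_max : is_max (hbar_values K D d v w pibar x y) (dotv y xi).
  split; first exact: (h_values_sub_hbar_values _ hv hw xb h_max.1).
  move=> b /(hbar_weak_duality xb pq_feas p_pibar) b_le.
  exact: le_trans b_le obj_le.
by rewrite /h /hbar (is_max_sup h_max) (is_max_sup hbar_max).
Qed.
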